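(* Let $\{W_k\}_{k\ge1}$ be i.i.d. random variables with finite moments of every order, $\mathbb{E}[W_1]=0$, $\mathbb{E}[W_1^2]=1$, and $\kappa_r(W_1)\ne0$ for all $r=2,\dots,q+1$, where $q\ge2$. Let $$F_n=\sum_{k\ge1}\alpha_{n,k}W_k\quad(n\in\mathbb{N}),\qquad F_\infty=\sum_{k=1}^q\alpha_{\infty,k}W_k,$$ where $\{\alpha_{n,k}\}_{n,k\ge1}\subset\mathbb{R}$, the real numbers $\alpha_{\infty,1},\dots,\alpha_{\infty,q}$ are non-zero and pairwise distinct, and $\sum_{k\ge1}\alpha_{n,k}^2=1$ for every $n$ and $\sum_{k=1}^q\alpha_{\infty,k}^2=1$. Let $\Delta(F_n)=\sum_{k\ge1}\alpha_{n,k}^2\prod_{r=1}^q(\alpha_{n,k}-\alpha_{\infty,r})^2$. Assume further that $\dim_{\mathbb{Q}}\operatorname{span}\{\alpha_{\infty,1}^2,\dots,\alpha_{\infty,q}^2\}=q$. Then there exists a constant $C>0$ depending only on the target $F_\infty$ such that, for all $n\ge1$, $$d_{\mathbf{W}_2}(F_n,F_\infty)\le C\sqrt{\Delta(F_n)}.$$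
   Context: $\kappa_r(\cdot)$ denotes the $r$-th cumulant. $\dim_{\mathbb{Q}}\operatorname{span}$ is the dimension of the $\mathbb{Q}$-linear span inside $\mathbb{R}$. $d_{\mathbf{W}_2}(F,G)$ is the Wasserstein distance of order 2 between the laws of real square-integrable random variables $F$ and $G$: $d_{\mathbf{W}_2}(F,G)=\big(\inf\mathbb{E}|X-Y|^2\big)^{1/2}$, the infimum being over all pairs $(X,Y)$ of random variables on a common probability space with $X$ distributed as $F$ and $Y$ distributed as $G$. The (possibly infinite) series defining $F_n$ converges in $L^2$. *)

(* Defs.v *)
From HB Require Import structures.
From mathcomp Require Import all_boot all_order all_algebra finmap.
From mathcomp Require Import all_classical all_reals all_analysis.
From mathcomp Require Import complex.

Set Implicit Arguments.
Unset Strict Implicit.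
Unset Printing Implicit Defensive.

Import Order.TTheory GRing.Theory Num.Theory.
Import numFieldNormedType.Exports.

Local Open Scope classical_set_scope.
Local Open Scope ring_scope.

Section Laws.
Context (R : realType).

Definition has_law (d : measure_display) (T : measurableType d)
    (P : probability T R) (X : {RV P >-> R})
    (mu : probability R R) : Prop :=
  forall A : set R, measurable A -> distribution P X A = mu A.
Arguments has_law {d T} P X mu.

Definition mutually_independent (d : measure_display) (T : measurableType d)
    (P : probability T R) (I : choiceType) (X : I -> {RV P >-> R}) : Prop :=
  forall (J : {fset I}) (A : I -> set R),
    (forall j, j \in J -> measurable (A j)) ->
    P (\bigcap_(j in [set` J]) (X j @^-1` A j)) =
    (\prod_(j <- J) P (X j @^-1` A j))%E.
Arguments mutually_independent {d T} P {I} X.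

Definition iid (d : measure_display) (T : measurableType d)
    (P : probability T R) (W : nat -> {RV P >-> R})
    (mu : probability R R) : Prop :=
  mutually_independent P W /\ forall k, has_law P (W k) mu.
Arguments iid {d T} P W mu.

(* The infimum ranges over pairs of random variables on an arbitrary common
   probability space, so it is taken in the extended reals. *)
Definition W2 (mu nu : probability R R) : \bar R :=
  sqrte (ereal_inf [set c : \bar R |
    exists (d : measure_display) (T : measurableType d) (P : probability T R)
           (X Y : {RV P >-> R}),
      [/\ has_law P X mu, has_law P Y nu
        & c = 'E_P[fun w => (`|X w - Y w| ^+ 2)%R]%E]]).

End Laws.

Arguments has_law {R d T} P X mu.
Arguments mutually_independent {R d T} P {I} X.
Arguments iid {R d T} P W mu.

Section Cumulants.
Context (R : realType) (d : measure_display) (T : measurableType d).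
Context (P : probability T R) (X : T -> R).

Definition char_fun (t : R) : R[i] :=
  Complex (fine 'E_P[fun w => (cos (t * X w))%R]%E)
          (fine 'E_P[fun w => (sin (t * X w))%R]%E).

(* Principal logarithm, for arguments with positive real part only; this
   covers the values of a characteristic function near 0. *)
Definition clog (z : R[i]) : R[i] :=
  Complex (ln (Normc.normc z)) (atan (complex.Im z / complex.Re z)).

(* kappa_r = (-i)^r (d/dt)^r log E[exp(itX)] at t = 0, which only needs a
   moment of order r (the moment generating function may be infinite off 0).
   This complex number is real, whence the final projection. *)
Definition cumulant (r : nat) : R :=
  let K := fun t => clog (char_fun t) in
  complex.Re ((- Complex 0 1) ^+ r *
    Complex (derive1n r (fun t => complex.Re (K t)) 0)
            (derive1n r (fun t => complex.Im (K t)) 0)).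

End Cumulants.

Section RationalSpan.
Context (R : realType).

Definition Qcomb (n : nat) (v : 'I_n -> R) (c : 'I_n -> rat) : R :=
  \sum_(i < n) ratr (c i) * v i.

Definition Qspan (n : nat) (v : 'I_n -> R) : set R :=
  [set x | exists c, x = Qcomb v c].

Definition Qfree (n : nat) (v : 'I_n -> R) : Prop :=
  forall c, Qcomb v c = 0 -> forall i, c i = 0.

Definition Qdim_eq (V : set R) (n : nat) : Prop :=
  exists b : 'I_n -> R, Qfree b /\ Qspan b = V.

End RationalSpan.

Section Series.
Context (R : realType).

Definition L2_sum (d : measure_display) (T : measurableType d)
    (P : probability T R) (a : nat -> R) (W : nat -> {RV P >-> R})
    (F : {RV P >-> R}) : Prop :=
  (fun N : nat => 'E_P[fun w => ((F w - \sum_(k < N) a k * W k w) ^+ 2)%R]%E)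
    @ \oo --> 0%E.

Definition Delta (q : nat) (ainf : 'I_q -> R) (a : nat -> R) : \bar R :=
  (\sum_(k <oo) (a k ^+ 2 * \prod_(r < q) (a k - ainf r) ^+ 2)%:E)%E.

End Series.

Arguments L2_sum {R d T} P a W F.

(* Main.v *)
(* Round each coefficient a_k to a nearest point b_k of {0, ainf_1, ..., ainf_q}:
   then (a_k - b_k)^2 <= K a_k^2 prod_r (a_k - ainf_r)^2, hence
   sum_k (a_k - b_k)^2 <= K Delta.  If m_r coefficients are rounded to ainf_r,
   then sum_r m_r ainf_r^2 is close to sum_k a_k^2 = 1 = sum_r ainf_r^2; the m_r
   are bounded, so rational independence of the ainf_r^2 forces every m_r = 1 as
   soon as Delta is small.  The rounded series is then
   sum_r ainf_r W_(s r) with s injective; it has the law of F_oo, which gives a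
   coupling of cost at most 2 K Delta.  If Delta is not small, the trivial
   coupling has bounded cost. *)
Require Import Defs.
From HB Require Import structures.
From mathcomp Require Import all_boot all_order all_algebra finmap.
From mathcomp Require Import all_classical all_reals all_analysis.
From mathcomp Require Import measurable_realfun ring lra.

Set Implicit Arguments.
Unset Strict Implicit.
Unset Printing Implicit Defensive.

Import Order.TTheory GRing.Theory Num.Theory.
Import numFieldNormedType.Exports.

Local Open Scope classical_set_scope.
Local Open Scope ring_scope.

(** * Rational independence from the dimension of the span *)

Section RationalRank.
Context (R : realType) (n : nat).

Lemma Qcomb_comp (b : 'I_n -> R) (N : 'I_n -> 'I_n -> rat) (c : 'I_n -> rat) :
  Qcomb (fun j => Qcomb b (N j)) c = Qcomb b (fun k => \sum_(j < n) c j * N j k).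
Proof.
rewrite /Qcomb; under eq_bigr do rewrite mulr_sumr.
rewrite exchange_big/=; apply: eq_bigr => k _.
rewrite rmorph_sum mulr_suml; apply: eq_bigr => j _.
by rewrite rmorphM mulrA.
Qed.

Lemma Qspan_mem (v : 'I_n -> R) i : Qspan v (v i).
Proof.
exists (fun j => (i == j)%:R); rewrite /Qcomb (bigD1 i)//= eqxx rmorph1 mul1r.
by rewrite big1 ?addr0// => j; rewrite eq_sym => /negbTE ->; rewrite rmorph0 mul0r.
Qed.

(** A free family [b] of size [n] and [v] span the same space, so each is a rational combination of
    the other, with matrices [MM] and [NN]. Freeness of [b] gives [MM *m NN = 1]; both are square,
    so [NN *m MM = 1] as well, and a relation [c] with [c *m NN = 0] must vanish. *)
Lemma Qdim_eq_Qfree (v : 'I_n -> R) : Qdim_eq (Qspan v) n -> Qfree v.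
Proof.
move=> [b [bfree bv]].
have /choice[M vM] i : exists c, b i = Qcomb v c by have := Qspan_mem b i; rewrite bv.
have /choice[N bN] i : exists c, v i = Qcomb b c by have := Qspan_mem v i; rewrite -bv.
have vE : v = fun i => Qcomb b (N i) by apply/funext.
pose MM := (\matrix_(i, j) M i j : 'M[rat]_n).
pose NN := (\matrix_(i, j) N i j : 'M[rat]_n).
have MN : MM *m NN = 1%:M.
  apply/matrixP => i k; rewrite !mxE; under eq_bigr do rewrite !mxE.
  apply/eqP; rewrite -subr_eq0; apply/eqP; move: k.
  apply: (bfree (fun k => \sum_(j < n) M i j * N j k - (i == k)%:R)).
  rewrite /Qcomb; under eq_bigr do rewrite rmorphB mulrBl.
  rewrite sumrB -/(Qcomb _ _) -Qcomb_comp -vE -vM.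
  rewrite (bigD1 i)//= eqxx rmorph1 mul1r big1 ?addr0 ?subrr// => j.
  by rewrite eq_sym => /negbTE ->; rewrite rmorph0 mul0r.
move=> c; rewrite vE Qcomb_comp => /bfree cN i.
have : \row_j c j *m NN = 0.
  by apply/rowP => k; rewrite !mxE -[RHS](cN k); apply: eq_bigr => j _; rewrite !mxE.
move=> /(congr1 (mulmx^~ MM)); rewrite -mulmxA (mulmx1C MN) mulmx1 mul0mx.
by move=> /rowP/(_ i); rewrite !mxE.
Qed.

End RationalRank.

(** * Rounding to a finite set and gaps between finitely many values *)

Lemma finite_lower_bound (R : realFieldType) (I : finType) (Q : pred I) (f : I -> R) :
  (forall i, Q i -> 0 < f i) -> exists2 m, 0 < m & forall i, Q i -> m <= f i.
Proof.
(* The default value 1 keeps the minimum positive when no index satisfies [Q]. *)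
move=> f0; exists (\big[Order.min/1]_(i | Q i) f i); first exact: lt_bigmin.
by move=> i Qi; exact: bigmin_le_cond.
Qed.

(** If [e] separates the points pairwise, every point other than the nearest one is at distance at
    least [e / 2] from [x]. The [n] remaining factors of the product are thus at least
    [(e / 2) ^+ 2] each, and [K] is the inverse of their combined lower bound. *)
Lemma dist_nearest_le_prod (R : realFieldType) (n : nat) (v : 'I_n.+1 -> R) :
  injective v -> exists2 K : R, 0 < K & forall x, exists s,
    (forall t, `|x - v s| <= `|x - v t|) /\
    (x - v s) ^+ 2 <= K * \prod_t (x - v t) ^+ 2.
Proof.
move=> vI.
have [e e0 ve] : exists2 e : R, 0 < e &
    forall p : 'I_n.+1 * 'I_n.+1, p.1 != p.2 -> e <= `|v p.1 - v p.2|.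
  apply: finite_lower_bound => -[s t]/= st.
  by rewrite normr_gt0 subr_eq0 (inj_eq vI).
have E0 : 0 < (e / 2) ^+ 2 by rewrite exprn_gt0 ?divr_gt0.
exists (((e / 2) ^+ 2) ^- n); first by rewrite invr_gt0 exprn_gt0.
move=> x; have [s _ smin] :=
  @Order.TotalTheory.arg_minP _ _ _ (@ord0 n) xpredT (fun s => `|x - v s|) isT.
have {}smin t : `|x - v s| <= `|x - v t| by apply: smin.
exists s; split => //.
rewrite (bigD1 s)//= mulrCA ler_peMr ?sqr_ge0//.
rewrite ler_pdivlMl; last exact: exprn_gt0.
rewrite mulr1.
have -> : ((e / 2) ^+ 2) ^+ n = \prod_(t < n.+1 | t != s) ((e / 2) ^+ 2).
  by rewrite prodr_const cardC1 card_ord.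
apply: ler_prod => t ts; rewrite (ltW E0)/=.
(* Triangle inequality through [x], with [v s] no farther from [x] than [v t]. *)
have et : e / 2 <= `|x - v t|.
  have := ve (s, t); rewrite eq_sym ts => /(_ isT)/=.
  have := smin t; have := ler_distD x (v s) (v t); rewrite (distrC (v s) x); lra.
rewrite -[leRHS]real_normK ?num_real// lerXn2r// nnegrE ?normr_ge0//.
by rewrite divr_ge0// ltW.
Qed.

(** Only finitely many [m] are bounded by [M], so the nonzero values of the distance have a positive
    lower bound [g]. Below [g] the distance is zero, and independence kills every coefficient
    [m r - 1]. *)
Lemma Qfree_sum_gap (R : realType) (q M : nat) (u : 'I_q -> R) :
  Qfree u -> exists2 g : R, 0 < g & forall m : 'I_q -> nat, (forall r, (m r <= M)%N) ->
    `|\sum_(r < q) (m r)%:R * u r - \sum_(r < q) u r| < g -> forall r, m r = 1%N.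
Proof.
move=> ufree.
pose f (m : 'I_q -> nat) := `|\sum_(r < q) (m r)%:R * u r - \sum_(r < q) u r|.
have f0 (m : 'I_q -> nat) : f m = 0 -> forall r, m r = 1%N.
  move/eqP; rewrite normr_eq0 -sumrB => /eqP mu0 r.
  have := ufree (fun r => (m r)%:R - 1); move=> /(_ _ r) h.
  apply/eqP; rewrite -(eqr_nat rat) -subr_eq0 h//.
  rewrite -[RHS]mu0; apply: eq_bigr => s _.
  by rewrite rmorphB rmorph1 rmorph_nat mulrBl mul1r.
have [|g g0 gf] := @finite_lower_bound R {ffun 'I_q -> 'I_M.+1}
  (fun m => f (fun r => m r) != 0) (fun m => f (fun r => m r)).
  by move=> m /= fm; rewrite lt_def fm normr_ge0.
exists g => // m mM fmg; apply: f0; apply/eqP/negPn/negP => fm0.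
have mE : m = (fun r => [ffun r => inord (m r)] r : 'I_M.+1) :> ('I_q -> nat).
  by apply/funext => r; rewrite ffunE inordK// ltnS.
move: fmg; rewrite -/(f m) ltNge => /negP; apply; rewrite mE.
by apply: gf; rewrite /= -mE.
Qed.

(** * Matching the coefficients with those of the target *)

Lemma nneseries_partial_sums (R : realType) (u : nat -> R) (L : R) :
  (forall k, 0 <= u k) -> (\sum_(k <oo) (u k)%:E = L%:E)%E ->
  (forall N, \sum_(k < N) u k <= L) /\
  (forall e : R, 0 < e -> exists N0, forall N, (N0 <= N)%N -> L - e <= \sum_(k < N) u k).
Proof.
move=> u0 uL; split=> [N|e e0].
  rewrite -lee_fin -uL -sumEFin -(big_mkord xpredT (fun k => (u k)%:E)).
  by apply: nneseries_lim_ge => k _ _; rewrite lee_fin.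
have : (\sum_(0 <= k < N) (u k)%:E)%E @[N --> \oo] --> L%:E.
  by rewrite -uL; apply: is_cvg_ereal_nneg_natsum => k _; rewrite lee_fin.
under eq_cvg do rewrite sumEFin big_mkord.
move=> /fine_cvgP[_] /cvgr_ge /(_ (L - e)).
case; first by rewrite ltrBlDr ltrDl.
by move=> N0 _ h; exists N0 => N NN0; apply: h.
Qed.

(** For injective [s], the coefficient sequence of the sum of the [ainf r * W (s r)]. Written as a
    sum over [r], it needs no inverse of [s] and exchanges with sums over [k]. *)
Definition placed (R : realType) (q : nat) (ainf : 'I_q -> R) (s : 'I_q -> nat)
    (k : nat) : R :=
  \sum_(r < q) if k == s r then ainf r else 0.

(** The deterministic core of the proof. [K] and [e] are fixed before the sequence [a], so the final
    constant can depend on the target alone. *)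
Lemma coefficient_matching (R : realType) (q : nat) (ainf : 'I_q -> R) :
  (forall r, ainf r != 0) -> injective ainf ->
  \sum_(r < q) ainf r ^+ 2 = 1 -> Qfree (fun r => ainf r ^+ 2) ->
  exists K e : R, [/\ 0 < K, 0 < e & forall (a : nat -> R) (x : R),
    (\sum_(k <oo) (a k ^+ 2)%:E = 1)%E ->
    (forall N, \sum_(k < N) a k ^+ 2 * \prod_(r < q) (a k - ainf r) ^+ 2 <= x) ->
    K * x <= e -> exists2 s : 'I_q -> nat, injective s &
      forall N, \sum_(k < N) (a k - placed ainf s k) ^+ 2 <= K * x].
Proof.
move=> a0 aI asum afree.
(* Index [ord0] stands for the candidate 0, whose factor in the product is the [a k ^+ 2] of
   [Delta]. *)
pose v (i : 'I_q.+1) := oapp ainf 0 (unlift ord0 i).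
have v0 : v ord0 = 0 by rewrite /v unlift_none.
have vS r : v (lift ord0 r) = ainf r by rewrite /v liftK.
have nl (r : 'I_q) : (ord0 == lift ord0 r) = false by [].
have vI : injective v.
  move=> i j; case: (unliftP ord0 i) => [r|] ->;
    case: (unliftP ord0 j) => [t|] ->; rewrite ?v0 ?vS//.
  - by move=> /aI ->.
  - by move=> /eqP; rewrite (negbTE (a0 _)).
  - by move=> /esym/eqP; rewrite (negbTE (a0 _)).
have [K K0 near] := dist_nearest_le_prod vI.
have [c c0 ca] : exists2 c : R, 0 < c & forall r : 'I_q, true -> c <= ainf r ^+ 2.
  by apply: finite_lower_bound => r _; rewrite exprn_even_gt0//= a0.
(* Rounding at most doubles absolute values, so the rounded squares sum to at most 4 and each
   nonzero value is taken at most [4 / c] times. *)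
have [M cM] : exists M : nat, 4 / c < M%:R.
  by exists (Num.bound (4 / c)); rewrite archi_boundP// divr_ge0// ltW.
have [g g0 gap] := Qfree_sum_gap M afree.
(* Rounding will move the sum of squares by at most [3 * e] and truncation costs [e], in total less
   than [g = 5 * e]. The threshold is [e ^+ 2] because [K * x] bounds a sum of squares. *)
pose e := g / 5; have e0 : 0 < e by rewrite divr_gt0.
exists K, (e ^+ 2); split => //; first by rewrite exprn_gt0.
move=> a x a1 ax Kx.
have [aN1 alim] := nneseries_partial_sums (fun k => sqr_ge0 (a k)) a1.
have /choice[s sP] := fun k => near (a k).
pose b k := v (s k).
have ab2 k : (a k - b k) ^+ 2 <= K * (a k ^+ 2 * \prod_(r < q) (a k - ainf r) ^+ 2).
  have [_] := sP k; rewrite big_ord_recl v0 subr0.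
  by under eq_bigr do rewrite vS.
(* 0 is one of the candidates for the nearest point. *)
have ab k : `|a k - b k| <= `|a k|.
  by have [/(_ ord0)] := sP k; rewrite v0 subr0.
have abx N : \sum_(k < N) (a k - b k) ^+ 2 <= K * x.
  apply: le_trans (ler_wpM2l (ltW K0) (ax N)); rewrite mulr_sumr.
  exact: ler_sum.
have b2 k : b k ^+ 2 <= 4 * a k ^+ 2.
  move: (ab k); rewrite -ler_sqr ?nnegrE// !real_normK ?num_real//.
  by move: (a k) (b k) => y z; nra.
have sE r k : s k = lift ord0 r -> b k = ainf r by rewrite /b => ->.
(* Past [N1] each [a k ^+ 2] is at most [c / 8], so [b k ^+ 2] is at most [c / 2], too small for a
   nonzero candidate. *)
have [N1 N1P] := alim (c / 8) ltac:(by rewrite divr_gt0).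
have bfin k : (N1 <= k)%N -> s k = ord0.
  move=> kN; case: (unliftP ord0 (s k)) => // r sk.
  have := b2 k; rewrite (sE _ _ sk) => ba.
  have := ca r isT; have := N1P k kN; have := aN1 k.+1.
  rewrite big_ord_recr/=; move: (\sum_(_ < k) _) (ainf r) ba => S y; move: (a k) => z.
  by move=> *; exfalso; clear sk; lra.
have [N2 N2P] := alim e e0.
pose N := maxn N1 N2.
pose m r := #|[pred k : 'I_N | s k == lift ord0 r]|.
have bsum : \sum_(k < N) b k ^+ 2 = \sum_(r < q) (m r)%:R * ainf r ^+ 2.
  transitivity (\sum_(k < N) \sum_(r < q) if s k == lift ord0 r then ainf r ^+ 2 else 0).
    apply: eq_bigr => k _; case: (unliftP ord0 (s k)) => [r sk|sk].
      rewrite (sE _ _ sk) (bigD1 r)//= sk eqxx big1 ?addr0// => t tr.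
      by rewrite (inj_eq lift_inj) eq_sym (negbTE tr).
    by rewrite /b sk v0 expr0n/= big1.
  rewrite exchange_big/=; apply: eq_bigr => r _.
  by rewrite -big_mkcond/= sumr_const mulr_natl.
have b4 : \sum_(k < N) b k ^+ 2 <= 4.
  apply: (@le_trans _ _ (\sum_(k < N) 4 * a k ^+ 2)); first exact: ler_sum.
  by rewrite -mulr_sumr; have := aN1 N; lra.
have mM r : (m r <= M)%N.
  rewrite -(ler_nat R) ltW//; apply: le_lt_trans cM.
  rewrite ler_pdivlMr//; apply: le_trans b4; rewrite bsum (bigD1 r)//=.
  apply: (@le_trans _ _ ((m r)%:R * ainf r ^+ 2)).
    by rewrite ler_wpM2l// ca.
  by rewrite lerDl sumr_ge0// => t _; rewrite mulr_ge0// sqr_ge0.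
have bclose : `|\sum_(k < N) b k ^+ 2 - 1| < g.
  have h1 : `|\sum_(k < N) a k ^+ 2 - \sum_(k < N) b k ^+ 2| <= 3 * e.
    rewrite -sumrB; apply: le_trans (ler_norm_sum _ _ _) _.
    (* AM-GM: 3 |a| |a - b| <= 3/2 (e a^2 + (a - b)^2 / e) *)
    apply: (@le_trans _ _ (\sum_(k < N)
        (3 / 2 * (e * a k ^+ 2 + e^-1 * (a k - b k) ^+ 2)))).
      apply: ler_sum => k _; rewrite subr_sqr normrM.
      have h : `|a k + b k| <= 3 * `|a k|.
        have -> : a k + b k = 2 * a k - (a k - b k) by ring.
        apply: le_trans (ler_normB _ _) _; rewrite normrM normr_nat.
        by have := ab k; lra.
      apply: le_trans (ler_wpM2l (normr_ge0 _) h) _.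
      rewrite -(real_normK (num_real (a k))) -(real_normK (num_real (a k - b k))).
      move: `|a k| `|a k - b k| => y z.
      have := sqr_ge0 (e * y - z) => h2.
      have -> : 3 / 2 * (e * y ^+ 2 + e^-1 * z ^+ 2) =
        z * (3 * y) + 3 / 2 * e^-1 * (e * y - z) ^+ 2 by field; rewrite gt_eqF.
      by rewrite lerDl mulr_ge0// mulr_ge0// invr_ge0 ltW.
    rewrite -mulr_sumr big_split/= -!mulr_sumr.
    have : e^-1 * \sum_(k < N) (a k - b k) ^+ 2 <= e.
      by rewrite ler_pdivrMl// -expr2 (le_trans (abx N)).
    have : e * \sum_(k < N) a k ^+ 2 <= e by rewrite ger_pMr.
    by lra.
  have := N2P N (leq_maxr _ _); have := aN1 N.
  move: h1; rewrite ltr_norml ler_norml => /andP[].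
  have -> : g = 5 * e by rewrite /e; field.
  by move=> *; apply/andP; split; lra.
have m1 r : m r = 1%N by apply: gap => //; rewrite asum -bsum.
(* Multiplicity one means that a single index [t r] is rounded to [ainf r]; these indices form the
   required injection. *)
have /choice[t tP] r : exists i : 'I_N, [pred k : 'I_N | s k == lift ord0 r] =i pred1 i.
  by have [i iP] := mem_card1 (m1 r); exists i.
have st r : s (t r) = lift ord0 r.
  by have := tP r (t r); rewrite !inE eqxx => /eqP.
exists (fun r => t r : nat).
  by move=> r r' /(congr1 s); rewrite !st => /lift_inj.
(* The rounded sequence equals [placed] at every index: below [N] by uniqueness of [t r], and beyond
   [N] because [bfin] makes both zero. *)
move=> N'; apply: le_trans (abx N'); rewrite le_eqVlt; apply/orP; left; apply/eqP.
apply: eq_bigr => k _; congr ((_ - _) ^+ 2); rewrite /placed.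
case: (unliftP ord0 (s k)) => [r sk|sk].
  have kN : (k < N)%N.
    rewrite ltnNge; apply/negP => Nk.
    have := bfin k (leq_trans (leq_maxl _ _) Nk); rewrite sk => /esym/eqP.
    by rewrite nl.
  have kt : k = t r :> nat.
    have := tP r (Ordinal kN); rewrite !inE/= sk eqxx => /esym/eqP/(congr1 val); exact.
  rewrite (sE _ _ sk) (bigD1 r)//= kt eqxx big1 ?addr0// => r' r'r.
  case: eqP => // /(congr1 s); rewrite !st => /lift_inj rr'.
  by rewrite rr' eqxx in r'r.
rewrite /b sk v0 big1// => r _; case: eqP => // kt.
by move: sk; rewrite kt st => /esym/eqP; rewrite nl.
Qed.

(** * Laws of linear combinations of i.i.d. variables *)

Section Rectangles.
Context (R : realType) (q : nat).

(** The pi-system of measurable boxes, which generates the product sigma-algebra on ['I_q -> R]. *)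
Definition rectangles : set (set ('I_q -> R)) :=
  [set B | exists2 A : 'I_q -> set R, (forall r, measurable (A r)) &
    B = [set f | forall r, A r (f r)]].

Lemma rectangles_setI : setI_closed rectangles.
Proof.
move=> _ _ [A mA ->] [B mB ->]; exists (fun r => A r `&` B r).
  by move=> r; apply: measurableI.
apply/seteqP; split => [f [fA fB] r|f fAB]; first by split.
by split => r; have [] := fAB r.
Qed.

Let X := g_sigma_algebraType rectangles.

Lemma measurable_lincomb_rectangles (c : 'I_q -> R) :
  measurable_fun setT (fun f : X => \sum_(r < q) c r * f r).
Proof.
apply: measurable_sum => r; apply: measurable_funM => //.
move=> _ A mA; rewrite setTI; apply: sub_sigma_algebra.
exists (fun s => if s == r then A else setT).
  by move=> s; case: ifP.
apply/seteqP; split => [f /= fA s|f /(_ r)]; last by rewrite eqxx.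
by case: eqP => [->|].
Qed.

Context (d : measure_display) (T : measurableType d) (P : probability T R).

Lemma measurable_to_rectangles (Y : 'I_q -> {RV P >-> R}) :
  measurable_fun setT (fun w : T => (fun r => Y r w) : X).
Proof.
apply: (@measurability _ _ T X setT (fun w : T => (fun r => Y r w) : X) rectangles) => //.
move=> _ [_ [A mA ->] <-]; rewrite setTI.
have -> : (fun w : T => (fun r => Y r w) : X) @^-1` [set f | forall r, A r (f r)] =
  \bigcap_(r in [set: 'I_q]) (Y r @^-1` A r).
  by apply/seteqP; split => w /= h => [r _|r]; apply: h.
apply: fin_bigcap_measurable => // r _.
rewrite -[X in measurable X]setTI; apply: measurable_funPT => //.
Qed.

End Rectangles.

Lemma iid_rectangle (R : realType) (q : nat) (d : measure_display)
    (T : measurableType d) (P : probability T R) (W : nat -> {RV P >-> R})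
    (mu : probability R R) (s : 'I_q -> nat) (A : 'I_q -> set R) :
  iid P W mu -> injective s -> (forall r, measurable (A r)) ->
  P [set w | forall r, A r (W (s r) w)] = (\prod_(r < q) mu (A r))%E.
Proof.
move=> [ind law] sI mA.
(* Independence is stated for events indexed by [k], so the sides [A r] are transported along
   [s]. *)
pose B k := if [pick r | s r == k] is Some r then A r else setT.
have Bs r : B (s r) = A r.
  by rewrite /B; case: pickP => [t /eqP/sI ->//|/(_ r)]; rewrite eqxx.
pose J := [fset s r | r in 'I_q]%fset.
have := ind J B; rewrite (_ : \bigcap_(j in _) _ = [set w | forall r, A r (W (s r) w)]).
  move=> ->; last by move=> _ /imfsetP[r _ ->]; rewrite Bs.
  rewrite big_imfset/=; last by move=> x y _ _; apply: sI.
  rewrite big_enum/=; apply: eq_bigr => r _; by rewrite Bs; exact: law.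
apply/seteqP; split => [w h r|w h _ /= /imfsetP[r _ ->]].
  by rewrite -Bs; apply: (h (s r)); apply/imfsetP; exists r.
by rewrite Bs.
Qed.

(** The vectors picked by [s] and by [t] give every rectangle the same mass, hence have the same law
    by uniqueness on a pi-system; the linear combination is a measurable function of the vector. *)
Lemma iid_lincomb_law (R : realType) (q : nat) (d : measure_display)
    (T : measurableType d) (P : probability T R) (W : nat -> {RV P >-> R})
    (mu : probability R R) (c : 'I_q -> R) (s t : 'I_q -> nat) (A : set R) :
  iid P W mu -> injective s -> injective t -> measurable A ->
  P [set w | A (\sum_(r < q) c r * W (s r) w)] =
  P [set w | A (\sum_(r < q) c r * W (t r) w)].
Proof.
move=> Wiid sI tI mA.
pose Phi (u : 'I_q -> nat) (w : T) : g_sigma_algebraType (@rectangles R q) :=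
  fun r => W (u r) w.
have mPhi u : measurable_fun setT (Phi u) :=
  measurable_to_rectangles (fun r => W (u r)).
pose rv u : {mfun T >-> g_sigma_algebraType (@rectangles R q)} :=
  HB.pack (Phi u) (isMeasurableFun.Build _ _ _ _ _ (mPhi u)).
have mB := measurable_lincomb_rectangles c measurableT mA.
rewrite setTI in mB.
set B := (X in measurable X) in mB.
rewrite -[LHS]/(distribution P (rv s) B) -[RHS]/(distribution P (rv t) B).
apply: (@measure_unique _ _ (g_sigma_algebraType (@rectangles R q))
  (@rectangles R q) (fun=> setT) _ _ _ _
  (distribution P (rv s)) (distribution P (rv t)) _ _ _ mB) => //.
- exact: rectangles_setI.
- by move=> _; exists (fun=> setT) => //; apply/seteqP; split.
- by apply/seteqP; split => // f _; exists 0%N.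
- move=> _ [D mD ->].
  by rewrite [LHS](iid_rectangle Wiid sI mD) [RHS](iid_rectangle Wiid tI mD).
- by move=> k; apply: (le_lt_trans (probability_le1 _ measurableT)); exact: ltry.
Qed.

(** * Integrability and orthogonality of the variables *)

Section Moments.
Context (R : realType) (d : measure_display) (T : measurableType d).
Context (P : probability T R).

Lemma has_law_integral (X : {RV P >-> R}) (mu : probability R R) (f : R -> \bar R) :
  has_law P X mu -> (\int[mu]_x f x = \int[distribution P X]_x f x)%E.
Proof. by move=> Xmu; apply: eq_measure_integral => A mA _; exact/esym/Xmu. Qed.

Context (W : nat -> {RV P >-> R}) (mu : probability R R).
Context (Wiid : iid P W mu).
Context (EW1 : 'E_P[W 0%N]%E = 0%E).
Context (EW2 : 'E_P[fun w => (W 0%N w ^+ 2)%R]%E = 1%E).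

Lemma measurable_fun_sqr : measurable_fun setT (fun x : R => (x ^+ 2)%:E).
Proof. by apply/measurable_EFinP; exact: exprn_measurable. Qed.

Lemma iid_second_moment k : (\int[P]_w ((W k w) ^+ 2)%:E = 1)%E.
Proof.
have msq := measurable_fun_sqr.
have sq0 x : (0 <= (x ^+ 2)%:E :> \bar R)%E by rewrite lee_fin sqr_ge0.
rewrite -EW2 unlock -(ge0_integral_distribution (W k) msq)//.
rewrite -(ge0_integral_distribution (W 0%N) msq)//.
by rewrite -!(has_law_integral _ (Wiid.2 _)).
Qed.

Lemma iid_integrable_mul i j : P.-integrable setT (fun w => (W i w * W j w)%:E).
Proof.
have Isq k : P.-integrable setT (fun w => (W k w ^+ 2)%:E).
  apply/integrableP; split; first by apply/measurable_EFinP; exact: measurable_funX.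
  under eq_integral do rewrite gee0_abs ?lee_fin ?sqr_ge0//.
  by rewrite iid_second_moment ltry.
apply: (le_integrable _ _ _ (integrableD _ (Isq i) (Isq j))) => //.
  by apply/measurable_EFinP; exact: measurable_funM.
move=> w _ /=; rewrite lee_fin [X in _ <= X]ger0_norm ?addr_ge0 ?sqr_ge0//.
rewrite normrM -(real_normK (num_real (W i w))) -(real_normK (num_real (W j w))).
move: `|_| `|W j w| (normr_ge0 (W i w)) (normr_ge0 (W j w)) => x y x0 y0; nra.
Qed.

Lemma iid_integrable k : P.-integrable setT (fun w => (W k w)%:E).
Proof.
have I1 : P.-integrable setT (fun w => (1 : R)%:E).
  by apply: finite_measure_integrable_cst.
have := iid_integrable_mul k k.
move=> /(integrableD measurableT I1) /le_integrable; apply => //.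
  by apply/measurable_EFinP.
move=> w _ /=; rewrite lee_fin [X in _ <= X]ger0_norm; last by nra.
by case: ger0P => _; nra.
Qed.

Lemma law_mean0 : (\int[mu]_x x%:E = 0)%E.
Proof.
rewrite (has_law_integral _ (Wiid.2 0%N)) integral_distribution//.
  by rewrite -EW1 unlock.
exact: iid_integrable.
Qed.

(** By independence the joint law of [(W i, W j)] is [mu \x mu]; Fubini then makes the inner
    integral a multiple of the mean, which is zero. *)
Lemma iid_orthogonal (i j : nat) : i != j -> (\int[P]_w (W i w * W j w)%:E = 0)%E.
Proof.
move=> ij; pose pr w := (W i w, W j w).
have mpr : measurable_fun setT pr by exact: measurable_fun_pair.
pose Z : {mfun T >-> (R * R)%type} := HB.pack pr (isMeasurableFun.Build _ _ _ _ _ mpr).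
pose f (z : R * R) := (z.1 * z.2)%:E.
have mf : measurable_fun setT f.
  by apply/measurable_EFinP; apply: measurable_funM.
have ZE A : measurable A -> (mu \x mu)%E A = distribution P Z A.
  apply: product_measure_unique => B C mB mC.
  have [ind law] := Wiid.
  have := ind [fset i; j]%fset (fun k => if k == i then B else C).
  rewrite big_fsetU1 ?inE//= big_seq_fset1 eqxx eq_sym (negbTE ij).
  have -> : P (W i @^-1` B) = mu B by exact: law.
  have -> : P (W j @^-1` C) = mu C by exact: law.
  move=> <-; last by move=> k _; case: ifP.
  congr (P _); apply/seteqP; split => [w [/= wB wC] k /=|w /= h].
    by rewrite !inE => /orP[]/eqP ->; rewrite ?eqxx// eq_sym (negbTE ij).
  split => /=; first by have := h i; rewrite /= !inE eqxx; apply.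
  by have := h j; rewrite /= !inE eqxx orbT eq_sym (negbTE ij); apply.
have intP : P.-integrable setT (f \o Z) by exact: iid_integrable_mul.
transitivity (\int[distribution P Z]_z f z)%E.
  by rewrite integral_distribution.
have intD : (distribution P Z).-integrable setT f.
  by apply: integrable_pushforward.
have intM : (mu \x mu)%E.-integrable setT f.
  apply/integrableP; split => //.
  rewrite (eq_measure_integral (distribution P Z)); last by move=> A mA _; exact: ZE.
  by case/integrableP: intD.
rewrite (eq_measure_integral (mu \x mu)%E); last by move=> A mA _; exact/esym/ZE.
rewrite -integral12_prod_meas1//.
rewrite integral0_eq// => x _; rewrite /fubini_F/=.
have intid : mu.-integrable setT EFin.
  apply/integrableP; split=> //.
  rewrite (has_law_integral _ (Wiid.2 0%N)).
  have h : (distribution P (W 0%N)).-integrable setT EFin.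
    by apply: integrable_pushforward => //; exact: iid_integrable.
  by case/integrableP: h.
transitivity (\int[mu]_y (x%:E * y%:E))%E; first by apply: eq_integral.
by rewrite integralZl// law_mean0 mule0.
Qed.

End Moments.

(** * Mean-square distance between an infinite and a finite sum *)

Section Orthonormal.
Context (R : realType) (d : measure_display) (T : measurableType d).
Context (P : probability T R) (W : nat -> {RV P >-> R}).
Context (Wint : forall i j, P.-integrable setT (fun w => (W i w * W j w)%:E)).
Context (Worth :
  forall i j, (\int[P]_w (W i w * W j w)%:E = (i == j)%:R%:E)%E).

Lemma orthonormal_norm2 (c : nat -> R) (N : nat) :
  (\int[P]_w ((\sum_(k < N) c k * W k w) ^+ 2)%:E =
   (\sum_(k < N) c k ^+ 2)%:E)%E.
Proof.
transitivity (\int[P]_w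
  \sum_(i < N) \sum_(j < N) ((c i * c j)%:E * (W i w * W j w)%:E))%E.
  apply: eq_integral => w _; rewrite expr2 big_distrlr/= -sumEFin.
  apply: eq_bigr => i _; rewrite -sumEFin; apply: eq_bigr => j _.
  by rewrite -EFinM mulrACA.
have Icc i j : P.-integrable setT (fun w => (c i * c j)%:E * (W i w * W j w)%:E)%E.
  by apply: integrableZl.
rewrite integral_sum//=; last by move=> i; apply: integrable_sum.
rewrite -sumEFin; apply: eq_bigr => i _.
rewrite integral_sum//= (bigD1 i)//= integralZl// Worth eqxx mule1 expr2.
rewrite big1 ?adde0// => j ji.
by rewrite integralZl// Worth -val_eqE/= eq_sym in ji *; rewrite (negbTE ji) mule0.
Qed.

(** With the partial sum [S N] in between, the squared distance is at most twice the truncation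
    error, which tends to 0, plus twice the sum of the [(a k - b k) ^+ 2]. Letting [N] grow leaves
    [2 * D]. *)
Lemma L2_sum_dist (a b : nat -> R) (F Y : {RV P >-> R}) (N0 : nat) (D : R) :
  L2_sum P a W F ->
  (forall N, (N0 <= N)%N -> forall w, Y w = \sum_(k < N) b k * W k w) ->
  (forall N, (N0 <= N)%N -> \sum_(k < N) (a k - b k) ^+ 2 <= D) ->
  ('E_P[fun w => (`|F w - Y w| ^+ 2)%R] <= (2 * D)%:E)%E.
Proof.
move=> aF bY abD.
pose S N w := \sum_(k < N) a k * W k w.
have mS (c : nat -> R) N : measurable_fun setT (fun w => \sum_(k < N) c k * W k w).
  by apply: measurable_sum => k; apply: measurable_funM.
pose u N := (2%:E * 'E_P[fun w => ((F w - S N w) ^+ 2)%R] + (2 * D)%:E)%E.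
have ulim : u N @[N --> \oo] --> (2 * D)%:E.
  rewrite -[X in _ --> X]add0e -(mule0 2%:E).
  apply: cvgeD; rewrite ?mule0//; last exact: cvg_cst.
  by rewrite -[X in _ --> X](mule0 2%:E); apply: cvgeZl.
rewrite -(cvg_lim _ ulim)//; apply: lime_ge; first by apply/cvg_ex; eexists; exact: ulim.
exists N0 => // N /= N0N.
have -> : u N = (\int[P]_w (2%:E * ((F w - S N w) ^+ 2)%:E) + (2 * D)%:E)%E.
  rewrite /u unlock ge0_integralZl//.
    by apply/measurable_EFinP; apply: measurable_funX; apply: measurable_funB => //; exact: mS.
  by move=> w _; rewrite lee_fin sqr_ge0.
have DE : (\int[P]_w (2%:E * ((\sum_(k < N) (a k - b k) * W k w) ^+ 2)%:E)
    <= (2 * D)%:E)%E.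
  rewrite ge0_integralZl//.
  - by rewrite (orthonormal_norm2 (fun k => a k - b k)) -EFinM lee_fin ler_pM2l ?abD.
  - apply/measurable_EFinP; apply: measurable_funX.
    exact: (mS (fun k => a k - b k)).
  - by move=> w _; rewrite lee_fin sqr_ge0.
apply: (le_trans _ (leeD2l _ DE)).
rewrite unlock -ge0_integralD//.
- apply: ge0_le_integral => //.
  + apply/measurable_EFinP; apply: measurable_funX.
    by apply: measurableT_comp => //; apply: measurable_funB.
  + apply: emeasurable_funD; apply: measurable_funeM; apply/measurable_EFinP;
      apply: measurable_funX.
      by apply: measurable_funB => //; exact: mS.
    exact: (mS (fun k => a k - b k)).
  + move=> w _; rewrite -!EFinM -EFinD lee_fin real_normK ?num_real//.
    rewrite (bY N N0N) [in X in _ <= _ + X]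
      (eq_bigr (fun k : 'I_N => a k * W k w - b k * W k w)); last by move=> k _; rewrite mulrBl.
    rewrite sumrB -/(S N w); move: (F w) (S N w) (\sum_(i < N) _) => f s y.
    (* This square is exactly [2 (f - s)^2 + 2 (s - y)^2 - (f - y)^2]. *)
    have := sqr_ge0 (f - 2 * s + y); nra.
- by move=> w _; rewrite mule_ge0// lee_fin sqr_ge0.
- apply: measurable_funeM; apply/measurable_EFinP; apply: measurable_funX.
  by apply: measurable_funB => //; exact: mS.
- by move=> w _; rewrite mule_ge0// lee_fin sqr_ge0.
- apply: measurable_funeM; apply/measurable_EFinP; apply: measurable_funX.
  exact: (mS (fun k => a k - b k)).
Qed.

End Orthonormal.

(** * Coupling with a relocated copy of the target *)

Lemma sum_placed (R : realType) (q : nat) (c : 'I_q -> R) (s : 'I_q -> nat)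
    (f : nat -> R) (N : nat) :
  \sum_(k < N) placed c s k * f k =
  \sum_(r < q) if (s r < N)%N then c r * f (s r) else 0.
Proof.
under eq_bigr do rewrite mulr_suml.
rewrite exchange_big/=; apply: eq_bigr => r _; case: ltnP => sN.
  rewrite (bigD1 (Ordinal sN))//= eqxx big1 ?addr0// => k.
  by rewrite -val_eqE/= => /negbTE ->; rewrite mul0r.
by rewrite big1// => k _; rewrite ltn_eqF ?mul0r// (leq_trans (ltn_ord k)).
Qed.

(** At most one summand is nonzero at each [k], so squaring produces no cross terms. *)
Lemma placed_sqr (R : realType) (q : nat) (c : 'I_q -> R) (s : 'I_q -> nat) k :
  injective s -> placed c s k ^+ 2 = placed (fun r => c r ^+ 2) s k.
Proof.
move=> sI; rewrite /placed; case: (pickP (fun r => k == s r)) => [r /eqP ->|k0].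
  have sr t : t != r -> (s r == s t) = false.
    by move=> tr; rewrite (inj_eq sI) eq_sym (negbTE tr).
  by rewrite [in LHS](bigD1 r)//= [in RHS](bigD1 r)//= eqxx !big1 ?addr0// => t /sr ->.
by rewrite !big1 ?expr0n// => r _; rewrite k0.
Qed.

Lemma sum_placed_sqr_le (R : realType) (q : nat) (c : 'I_q -> R) (s : 'I_q -> nat)
    (N : nat) :
  injective s -> \sum_(k < N) placed c s k ^+ 2 <= \sum_(r < q) c r ^+ 2.
Proof.
move=> sI; have := sum_placed (fun r => c r ^+ 2) s (fun=> 1) N.
under eq_bigr do rewrite mulr1 -placed_sqr//.
move=> ->; apply: ler_sum => r _; case: ifP => _; first by rewrite mulr1.
exact: sqr_ge0.
Qed.

Lemma W2_le_coupling (R : realType) (d : measure_display) (T : measurableType d)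
    (P : probability T R) (X Y : {RV P >-> R}) (mu nu : probability R R) :
  has_law P X mu -> has_law P Y nu ->
  (W2 mu nu <= sqrte 'E_P[fun w => (`|X w - Y w| ^+ 2)%R])%E.
Proof.
move=> Xmu Ynu; rewrite /W2 lee_sqrt; last first.
  by apply: expectation_ge0 => w; rewrite exprn_ge0.
by apply: ereal_inf_lbound; exists d, T, P, X, Y.
Qed.

(** The coupling pairs [F] with the sum of the [ainf r * W (s r)], which lives on the same space and
    has the law of [Finf]. *)
Lemma W2_le_placed (R : realType) (q : nat) (ainf : 'I_q -> R)
    (mu : probability R R) (d : measure_display) (T : measurableType d)
    (P : probability T R) (W : nat -> {RV P >-> R})
    (a : nat -> R) (F Finf : {RV P >-> R}) (s : 'I_q -> nat) (D : R) :
  iid P W mu -> 'E_P[W 0%N]%E = 0%E ->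
  'E_P[fun w => (W 0%N w ^+ 2)%R]%E = 1%E ->
  L2_sum P a W F -> (forall w, Finf w = \sum_(k < q) ainf k * W k w) ->
  injective s ->
  (forall N, \sum_(k < N) (a k - placed ainf s k) ^+ 2 <= D) ->
  (W2 (distribution P F) (distribution P Finf) <= sqrte (2 * D)%:E)%E.
Proof.
move=> Wiid EW1 EW2 aF FinfE sI aD.
pose y w := \sum_(r < q) ainf r * W (s r) w.
have my : measurable_fun setT y.
  by apply: measurable_sum => r; apply: measurable_funM.
pose Y : {mfun T >-> R} := HB.pack y (isMeasurableFun.Build _ _ _ _ _ my).
have YF : has_law P Y (distribution P Finf).
  move=> A mA; transitivity (P [set w | A (\sum_(r < q) ainf r * W r w)]).
    exact: (iid_lincomb_law ainf Wiid sI val_inj mA).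
  by congr (P _); apply/seteqP; split => w /=; rewrite FinfE.
apply: le_trans (@W2_le_coupling R d T P F Y _ _ _ YF) _; first by [].
have D0 : 0 <= D by have := aD 0%N; rewrite big_ord0.
rewrite lee_sqrt; last by rewrite lee_fin mulr_ge0.
have Wint := iid_integrable_mul Wiid EW2.
have Worth i j : (\int[P]_w (W i w * W j w)%:E = (i == j)%:R%:E)%E.
  case: eqVneq => [->|ij]; last exact: (iid_orthogonal Wiid EW1 EW2 ij).
  by rewrite -(iid_second_moment Wiid EW2 j); apply: eq_integral => w _; rewrite expr2.
apply: (L2_sum_dist Wint Worth (N0 := (\max_(r < q) s r).+1) aF) => // N sN w.
(* From one past the largest [s r] on, the truncated sum contains every placed coefficient. *)
rewrite (sum_placed ainf s (fun k => W k w)); apply: eq_bigr => r _.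
by rewrite (leq_trans _ sN)// ltnS; apply: leq_bigmax.
Qed.

(* Sequences indexed by k >= 1 or n >= 1 in the text are indexed from 0 here.
   The constant is chosen from the data of the target F_oo alone: q, the
   coefficients ainf and the law mu of W_1. *)
Theorem theorem3p2 (R : realType) (q : nat) (ainf : 'I_q -> R)
    (mu : probability R R) :
  (2 <= q)%N ->
  (forall r, ainf r != 0) ->
  injective ainf ->
  \sum_(r < q) ainf r ^+ 2 = 1 ->
  Qdim_eq (Qspan (fun r => ainf r ^+ 2)) q ->
  exists C : R, 0 < C /\
    forall (d : measure_display) (T : measurableType d) (P : probability T R)
           (W : nat -> {RV P >-> R}),
      iid P W mu ->
      (forall r : nat, P.-integrable setT (fun w => (W 0%N w ^+ r)%:E)) ->
      'E_P[W 0%N]%E = 0%E ->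
      'E_P[fun w => (W 0%N w ^+ 2)%R]%E = 1%E ->
      (forall r : nat, (2 <= r <= q.+1)%N -> cumulant P (W 0%N) r != 0) ->
    forall (a : nat -> nat -> R) (F : nat -> {RV P >-> R})
           (Finf : {RV P >-> R}),
      (forall n, (\sum_(k <oo) (a n k ^+ 2)%:E)%E = 1%E) ->
      (forall n, L2_sum P (a n) W (F n)) ->
      (forall w, Finf w = \sum_(k < q) ainf k * W k w) ->
    forall n, (W2 (distribution P (F n)) (distribution P Finf)
                 <= C%:E * sqrte (Delta ainf (a n)))%E.
Proof.
move=> q2 a0 aI asum adim.
have [K [e [K0 e0 match_]]] := coefficient_matching a0 aI asum (Qdim_eq_Qfree adim).
(* The first term covers the matched case, with cost [2 * (K * x)]; the second covers [K * x > e],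
   where the cost is at most [2 * 4]. *)
pose c := 2 * K + 8 * K / e.
have c0 : 0 < c by rewrite addr_gt0 ?mulr_gt0 ?divr_gt0 ?invr_gt0.
exists (Num.sqrt c); split; first by rewrite sqrtr_gt0.
move=> d T P W Wiid _ EW1 EW2 _ a F Finf a1 aF FinfE n.
have t0 k : 0 <= a n k ^+ 2 * \prod_(r < q) (a n k - ainf r) ^+ 2.
  by rewrite mulr_ge0 ?sqr_ge0// prodr_ge0// => r _; exact: sqr_ge0.
have : (0 <= Delta ainf (a n))%E by apply: nneseries_ge0 => k _ _; rewrite lee_fin.
(* An infinite [Delta] makes the right-hand side infinite. *)
case Dx : (Delta ainf (a n)) => [x| |] // x0; last first.
  by rewrite /= gt0_muley ?leey// lte_fin sqrtr_gt0.
rewrite lee_fin in x0.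
have [ax _] := nneseries_partial_sums t0 Dx.
have bound s D : injective s ->
    (forall N, \sum_(k < N) (a n k - placed ainf s k) ^+ 2 <= D) -> 2 * D <= c * x ->
    (W2 (distribution P (F n)) (distribution P Finf) <=
      (Num.sqrt c)%:E * sqrte x%:E)%E.
  move=> sI aD Dc; apply: le_trans (W2_le_placed Wiid EW1 EW2 (aF n) FinfE sI aD) _.
  by rewrite /= -EFinM -sqrtrM ?(ltW c0)// lee_fin ler_wsqrtr.
have ce : c * x = 2 * (K * x) + 8 * (K * x / e) by rewrite /c; ring.
have [Kxe|eKx] := leP (K * x) e.
  have [s sI sD] := match_ _ _ (a1 n) ax Kxe.
  apply: bound sI sD _; rewrite ce lerDl mulr_ge0// divr_ge0 ?(ltW e0)//.
  by rewrite mulr_ge0// ltW.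
(* Without a matching, [F n] is compared with the target in its original position: both coefficient
   sequences have squares summing to at most 1, so [D = 2 + 2]. *)
apply: (bound (fun r : 'I_q => r : nat) 4 val_inj); last first.
  have : 1 <= K * x / e by rewrite ler_pdivlMr// mul1r ltW.
  by have : 0 <= K * x; [rewrite mulr_ge0 ?(ltW K0)|rewrite ce; lra].
move=> N; have [aN _] := nneseries_partial_sums (fun k => sqr_ge0 (a n k)) (a1 n).
have := aN N; have := sum_placed_sqr_le ainf N (val_inj : injective (fun r : 'I_q => r : nat)).
rewrite asum => b1 {}aN.
apply: (@le_trans _ _ (\sum_(k < N) (2 * a n k ^+ 2 + 2 * placed ainf (fun r => r) k ^+ 2))).
  apply: ler_sum => k _; move: (a n k) (placed _ _ k) => u v.
  by have := sqr_ge0 (u + v); nra.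
by rewrite big_split/= -!mulr_sumr; lra.
Qed.
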